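(* The logic $LET_K^+$ is algebraizable in the sense of Blok and Pigozzi.
   Context: Formulas are built from a denumerable set of propositional variables over $\Sigma=\{\land,\lor,\to,\neg,\circ\}$. The logic $LET_K$ is the natural deduction system with rules: ($\land$I) from $A,B$ infer $A\land B$; ($\land$E) from $A\land B$ infer $A$ and $B$; ($\lor$I) from $A$ (or from $B$) infer $A\lor B$; ($\lor$E) from $A\lor B$ and derivations of $C$ from $[A]$ and from $[B]$ infer $C$; ($\neg\land$I) from $\neg A$ (or $\neg B$) infer $\neg(A\land B)$; ($\neg\land$E) from $\neg(A\land B)$ and derivations of $C$ from $[\neg A]$ and from $[\neg B]$ infer $C$; ($\neg\lor$I) from $\neg A,\neg B$ infer $\neg(A\lor B)$; ($\neg\lor$E) from $\neg(A\lor B)$ infer $\neg A$ and $\neg B$; (DN) $A$ and $\neg\neg A$ are inter-derivable; ($\to$I) from a derivation of $B$ from $[A]$ infer $A\to B$; ($\to$E) from $A\to B$ and $A$ infer $B$; ($\to_{CL}$) axiom $A\lor(A\to B)$; ($\neg\to$I) from $A,\neg B$ infer $\neg(A\to B)$; ($\neg\to$E) from $\neg(A\to B)$ infer $A$ and $\neg B$; (EXP$^\circ$) from $\circ A,A,\neg A$ infer $B$; (PEM$^\circ$) from $\circ A$ infer $A\lor\neg A$ (bracketed hypotheses are discharged). Write $A^T$ for $\circ A\land A$, $A^F$ for $\circ A\land\neg A$. $LET_K^+$ adds: (I$\circ$) axiom $\circ\circ A$; (I$\neg\circ$) from $\circ A$ infer $\circ\neg A$; (E$\neg\circ$) from $\circ\neg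 A$ infer $\circ A$; (I$\land$T) from $A^T,B^T$ infer $(A\land B)^T$; (I$\land$F) from $A^F$ (or $B^F$) infer $(A\land B)^F$; (I$\lor$T) from $A^T$ (or $B^T$) infer $(A\lor B)^T$; (I$\lor$F) from $A^F,B^F$ infer $(A\lor B)^F$; (I$\to$T) from $A^F$ (or $B^T$) infer $(A\to B)^T$; (I$\to$F) from $A,B^F$ infer $(A\to B)^F$; (E$\land$T) from $(A\land B)^T$ infer $A^T$ and $B^T$; (E$\land$F) from $(A\land B)^F$ and derivations of $C$ from $[A^F]$ and from $[B^F]$ infer $C$; (E$\lor$T) from $(A\lor B)^T$ and derivations of $C$ from $[A^T]$ and from $[B^T]$ infer $C$; (E$\lor$F) from $(A\lor B)^F$ infer $A^F$ and $B^F$; (E$\to$T) from $(A\to B)^T$ and derivations of $C$ from $[A^F]$ and from $[B^T]$ infer $C$; (E$\to$F) from $(A\to B)^F$ infer $A$ and $B^F$. The consequence relation $\vdash_{LET_K^+}$ is derivability from premises; it is a structural finitary logic over $\Sigma$. *)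

(* Defs.v *)
From Stdlib Require List.
From mathcomp Require Import all_boot boolp classical_sets cardinality.

Set Implicit Arguments.
Unset Strict Implicit.
Unset Printing Implicit Defensive.

Local Open Scope classical_set_scope.

Inductive form : Type :=
| Var of nat
| And of form & form
| Or of form & form
| Imp of form & form
| Neg of form
| Circ of form.

Declare Scope form_scope.
Delimit Scope form_scope with form.
Bind Scope form_scope with form.

Notation "A ⋏ B" := (And A B) (at level 40, left associativity) : form_scope.
Notation "A ⋎ B" := (Or A B) (at level 50, left associativity) : form_scope.
Notation "A ⊃ B" := (Imp A B) (at level 55, right associativity) : form_scope.
Notation "∼ A" := (Neg A) (at level 35, right associativity) : form_scope.
Notation "∘ A" := (Circ A) (at level 35, right associativity) : form_scope.

Local Open Scope form_scope.

Fixpoint subst (s : nat -> form) (A : form) : form :=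
  match A with
  | Var n => s n
  | B ⋏ C => subst s B ⋏ subst s C
  | B ⋎ C => subst s B ⋎ subst s C
  | B ⊃ C => subst s B ⊃ subst s C
  | ∼ B => ∼ subst s B
  | ∘ B => ∘ subst s B
  end.

Fixpoint vars (A : form) : set nat :=
  match A with
  | Var n => [set n]
  | B ⋏ C | B ⋎ C | B ⊃ C => vars B `|` vars C
  | ∼ B | ∘ B => vars B
  end.

(* [tru A] and [fls A] are A^T and A^F. *)
Definition tru (A : form) : form := ∘ A ⋏ A.
Definition fls (A : form) : form := ∘ A ⋏ ∼ A.

(* [LETKp Γ A] is Γ ⊢ A in LET_K^+: there is a derivation of A whose open hypotheses all belong to
   the (possibly infinite) set Γ.  A hypothesis that a rule discharges is an
   extra element of the context of the corresponding premise. *)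
Inductive LETKp : set form -> form -> Prop :=
| r_hyp Γ A : Γ A -> LETKp Γ A
| r_andI Γ A B : LETKp Γ A -> LETKp Γ B -> LETKp Γ (A ⋏ B)
| r_andEl Γ A B : LETKp Γ (A ⋏ B) -> LETKp Γ A
| r_andEr Γ A B : LETKp Γ (A ⋏ B) -> LETKp Γ B
| r_orIl Γ A B : LETKp Γ A -> LETKp Γ (A ⋎ B)
| r_orIr Γ A B : LETKp Γ B -> LETKp Γ (A ⋎ B)
| r_orE Γ A B C : LETKp Γ (A ⋎ B) ->
    LETKp (Γ `|` [set A]) C -> LETKp (Γ `|` [set B]) C -> LETKp Γ C
| r_nandIl Γ A B : LETKp Γ (∼ A) -> LETKp Γ (∼ (A ⋏ B))
| r_nandIr Γ A B : LETKp Γ (∼ B) -> LETKp Γ (∼ (A ⋏ B))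
| r_nandE Γ A B C : LETKp Γ (∼ (A ⋏ B)) ->
    LETKp (Γ `|` [set ∼ A]) C -> LETKp (Γ `|` [set ∼ B]) C -> LETKp Γ C
| r_norI Γ A B : LETKp Γ (∼ A) -> LETKp Γ (∼ B) -> LETKp Γ (∼ (A ⋎ B))
| r_norEl Γ A B : LETKp Γ (∼ (A ⋎ B)) -> LETKp Γ (∼ A)
| r_norEr Γ A B : LETKp Γ (∼ (A ⋎ B)) -> LETKp Γ (∼ B)
| r_dnI Γ A : LETKp Γ A -> LETKp Γ (∼ ∼ A)
| r_dnE Γ A : LETKp Γ (∼ ∼ A) -> LETKp Γ A
| r_impI Γ A B : LETKp (Γ `|` [set A]) B -> LETKp Γ (A ⊃ B)
| r_impE Γ A B : LETKp Γ (A ⊃ B) -> LETKp Γ A -> LETKp Γ B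
| r_impCL Γ A B : LETKp Γ (A ⋎ (A ⊃ B))
| r_nimpI Γ A B : LETKp Γ A -> LETKp Γ (∼ B) -> LETKp Γ (∼ (A ⊃ B))
| r_nimpEl Γ A B : LETKp Γ (∼ (A ⊃ B)) -> LETKp Γ A
| r_nimpEr Γ A B : LETKp Γ (∼ (A ⊃ B)) -> LETKp Γ (∼ B)
| r_exp Γ A B : LETKp Γ (∘ A) -> LETKp Γ A -> LETKp Γ (∼ A) -> LETKp Γ B
| r_pem Γ A : LETKp Γ (∘ A) -> LETKp Γ (A ⋎ ∼ A)
| r_circcirc Γ A : LETKp Γ (∘ ∘ A)
| r_circnegI Γ A : LETKp Γ (∘ A) -> LETKp Γ (∘ ∼ A)
| r_circnegE Γ A : LETKp Γ (∘ ∼ A) -> LETKp Γ (∘ A)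
| r_andTI Γ A B : LETKp Γ (tru A) -> LETKp Γ (tru B) -> LETKp Γ (tru (A ⋏ B))
| r_andFIl Γ A B : LETKp Γ (fls A) -> LETKp Γ (fls (A ⋏ B))
| r_andFIr Γ A B : LETKp Γ (fls B) -> LETKp Γ (fls (A ⋏ B))
| r_orTIl Γ A B : LETKp Γ (tru A) -> LETKp Γ (tru (A ⋎ B))
| r_orTIr Γ A B : LETKp Γ (tru B) -> LETKp Γ (tru (A ⋎ B))
| r_orFI Γ A B : LETKp Γ (fls A) -> LETKp Γ (fls B) -> LETKp Γ (fls (A ⋎ B))
| r_impTIl Γ A B : LETKp Γ (fls A) -> LETKp Γ (tru (A ⊃ B))
| r_impTIr Γ A B : LETKp Γ (tru B) -> LETKp Γ (tru (A ⊃ B))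
| r_impFI Γ A B : LETKp Γ A -> LETKp Γ (fls B) -> LETKp Γ (fls (A ⊃ B))
| r_andTEl Γ A B : LETKp Γ (tru (A ⋏ B)) -> LETKp Γ (tru A)
| r_andTEr Γ A B : LETKp Γ (tru (A ⋏ B)) -> LETKp Γ (tru B)
| r_andFE Γ A B C : LETKp Γ (fls (A ⋏ B)) ->
    LETKp (Γ `|` [set fls A]) C -> LETKp (Γ `|` [set fls B]) C -> LETKp Γ C
| r_orTE Γ A B C : LETKp Γ (tru (A ⋎ B)) ->
    LETKp (Γ `|` [set tru A]) C -> LETKp (Γ `|` [set tru B]) C -> LETKp Γ C
| r_orFEl Γ A B : LETKp Γ (fls (A ⋎ B)) -> LETKp Γ (fls A)
| r_orFEr Γ A B : LETKp Γ (fls (A ⋎ B)) -> LETKp Γ (fls B)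
| r_impTE Γ A B C : LETKp Γ (tru (A ⊃ B)) ->
    LETKp (Γ `|` [set fls A]) C -> LETKp (Γ `|` [set tru B]) C -> LETKp Γ C
| r_impFEl Γ A B : LETKp Γ (fls (A ⊃ B)) -> LETKp Γ A
| r_impFEr Γ A B : LETKp Γ (fls (A ⊃ B)) -> LETKp Γ (fls B).

Record deductive_system : Type := DeductiveSystem {
  entails :> set form -> form -> Prop;
  _ : forall (Γ : set form) (A : form), Γ A -> entails Γ A;
  _ : forall (Γ Δ : set form) (A : form),
      Γ `<=` Δ -> entails Γ A -> entails Δ A;
  _ : forall (Γ Δ : set form) (A : form),
      (forall B, Δ B -> entails Γ B) -> entails Δ A -> entails Γ A;
  _ : forall (Γ : set form) (A : form), entails Γ A ->
      exists Γ0 : set form, [/\ finite_set Γ0, Γ0 `<=` Γ & entails Γ0 A];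
  _ : forall (s : nat -> form) (Γ : set form) (A : form),
      entails Γ A -> entails (subst s @` Γ) (subst s A)
}.

Record algebra : Type := Algebra {
  carrier :> Type;
  _ : inhabited carrier;
  opAnd : carrier -> carrier -> carrier;
  opOr : carrier -> carrier -> carrier;
  opImp : carrier -> carrier -> carrier;
  opNeg : carrier -> carrier;
  opCirc : carrier -> carrier
}.

Fixpoint eval (X : algebra) (v : nat -> X) (A : form) : X :=
  match A with
  | Var n => v n
  | B ⋏ C => opAnd (eval v B) (eval v C)
  | B ⋎ C => opOr (eval v B) (eval v C)
  | B ⊃ C => opImp (eval v B) (eval v C)
  | ∼ B => opNeg (eval v B)
  | ∘ B => opCirc (eval v B)
  end.

(* The pair (A, B) stands for the equation A ≈ B. *)
Definition equation : Type := (form * form)%type.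

Definition satisfies (X : algebra) (v : nat -> X) (e : equation) : Prop :=
  eval v e.1 = eval v e.2.

Definition eq_conseq (K : set algebra) (Θ : set equation) (e : equation) : Prop :=
  forall X : algebra, K X -> forall v : nat -> X,
    (forall e', Θ e' -> satisfies v e') -> satisfies v e.

Definition eq_conseq_set (K : set algebra) (Θ Θ' : set equation) : Prop :=
  forall e, Θ' e -> eq_conseq K Θ e.

(* A formula in one variable p (resp. two variables p, q) is a formula over
   the variable 0 (resp. 0 and 1); [inst1] and [inst2] instantiate them. *)
Definition inst1 (D : form) (A : form) : form := subst (fun=> A) D.
Definition inst2 (D : form) (A B : form) : form :=
  subst (fun n => if n is 0 then A else B) D.

Definition defining_equations (E : set equation) : Prop :=
  finite_set E /\
  forall e, E e -> vars e.1 `<=` [set 0] /\ vars e.2 `<=` [set 0].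

Definition equivalence_formulas (D : set form) : Prop :=
  finite_set D /\ forall d, D d -> vars d `<=` [set 0; 1].

Definition to_equations (E : set equation) (Γ : set form) : set equation :=
  [set (inst1 e.1 A, inst1 e.2 A) | e in E & A in Γ].

Definition to_formulas (D : set form) (A B : form) : set form :=
  [set inst2 d A B | d in D].

Definition algebraic_semantics (L : deductive_system) (K : set algebra)
    (E : set equation) : Prop :=
  forall (Γ : set form) (A : form),
    L Γ A <-> eq_conseq_set K (to_equations E Γ) (to_equations E [set A]).

Definition equivalent_algebraic_semantics (L : deductive_system)
    (K : set algebra) (E : set equation) (D : set form) : Prop :=
  algebraic_semantics L K E /\
  forall A B : form,
    eq_conseq_set K [set (A, B)] (to_equations E (to_formulas D A B)) /\
    eq_conseq_set K (to_equations E (to_formulas D A B)) [set (A, B)].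

(* As in Blok and Pigozzi, K is an arbitrary class of algebras; it is not
   required to be a quasivariety. *)
Definition algebraizable (L : deductive_system) : Prop :=
  exists (K : set algebra) (E : set equation) (D : set form),
    [/\ defining_equations E, equivalence_formulas D &
        equivalent_algebraic_semantics L K E D].

Lemma setU1S (T : Type) (Γ Δ : set T) (A : T) :
  Γ `<=` Δ -> Γ `|` [set A] `<=` Δ `|` [set A].
Proof. by move=> sub B [/sub|->]; [left | right]. Qed.

Lemma LETKp_mono Γ Δ A : Γ `<=` Δ -> LETKp Γ A -> LETKp Δ A.
Proof.
move=> sub d; elim: d Δ sub => {Γ A} *;
  solve [constructor; auto | econstructor; eauto using setU1S].
Qed.

Lemma LETKp_cut Γ Δ A :
  (forall B, Δ B -> LETKp Γ B) -> LETKp Δ A -> LETKp Γ A.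
Proof.
move=> sub d.
have ext Γ1 Δ1 C : (forall B, Δ1 B -> LETKp Γ1 B) ->
    forall B, (Δ1 `|` [set C]) B -> LETKp (Γ1 `|` [set C]) B.
  move=> h B [/h|->]; last by apply: r_hyp; right.
  by apply: LETKp_mono => X; left.
elim: d Γ sub => {Δ A} *; solve [auto | econstructor; eauto using ext].
Qed.

Lemma LETKp_subst s Γ A : LETKp Γ A -> LETKp (subst s @` Γ) (subst s A).
Proof.
have ext Γ1 C B : LETKp (subst s @` (Γ1 `|` [set C])) B ->
    LETKp (subst s @` Γ1 `|` [set subst s C]) B.
  by rewrite image_setU image_set1.
elim=> {Γ A}; rewrite /tru /fls /=;
  try by move=> Γ A GA; apply: r_hyp; exists A.
all: move=> *; repeat match goal with H : _ |- _ => apply ext in H end.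
all: solve [econstructor; eauto].
Qed.

Definition fin_entails (Γ : set form) (A : form) : Prop :=
  exists Γ0 : set form, [/\ finite_set Γ0, Γ0 `<=` Γ & LETKp Γ0 A].

Lemma fin_cut Γ (s : seq form) A :
  (forall B, List.In B s -> fin_entails Γ B) ->
  LETKp [set B | List.In B s] A -> fin_entails Γ A.
Proof.
move=> h d.
suff [Γ0 [fin0 sub0 d0]] : exists Γ0 : set form, [/\ finite_set Γ0,
    Γ0 `<=` Γ & forall B, List.In B s -> LETKp Γ0 B].
  by exists Γ0; split=> //; apply: LETKp_cut d.
elim: s h {d} => [|C s IH] h; first by exists set0; split.
have [|Γ1 [fin1 sub1 d1]] := IH; first by move=> B sB; apply: h; right.
have [|Γ2 [fin2 sub2 d2]] := h C; first by left.
exists (Γ1 `|` Γ2); split; first by rewrite finite_setU.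
  by move=> B [/sub1|/sub2].
move=> B [<-|/d1]; first by apply: LETKp_mono d2 => X; right.
by apply: LETKp_mono => X; left.
Qed.

Lemma fin_deduction Γ A B :
  fin_entails (Γ `|` [set A]) B -> fin_entails Γ (A ⊃ B).
Proof.
move=> [Γ0 [fin0 sub0 d0]]; exists (Γ0 `\` [set A]); split.
- exact: finite_setD.
- by move=> C [/sub0[]].
apply: r_impI; apply: LETKp_mono d0 => C G0C.
by have [->|nCA] := pselect (C = A); [right | left; split].
Qed.

Lemma LETKp_finitary Γ A : LETKp Γ A -> fin_entails Γ A.
Proof.
have hyp s C : List.In C s -> LETKp [set B | List.In B s] C by exact: r_hyp.
have mp s C D : List.In (C ⊃ D) s ->
    LETKp ([set B | List.In B s] `|` [set C]) D.
  move=> sCD; apply: (@r_impE _ C); last by apply: r_hyp; right.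
  by apply: r_hyp; left.
elim=> {Γ A}; first by move=> Γ A GA; exists [set A]; split;
  [exact: finite_set1 | by move=> _ -> | exact: r_hyp].
all: move=> *; repeat match goal with
  H : fin_entails (_ `|` _) _ |- _ => apply fin_deduction in H end.
all: match goal with
  | H1 : fin_entails _ ?A, H2 : fin_entails _ ?B, H3 : fin_entails _ ?C
      |- _ => apply (@fin_cut _ [:: A; B; C])
  | H1 : fin_entails _ ?A, H2 : fin_entails _ ?B |- _ =>
      apply (@fin_cut _ [:: A; B])
  | H1 : fin_entails _ ?A |- _ => apply (@fin_cut _ [:: A])
  | _ => apply (@fin_cut _ [::])
  end; first by move=> ? /=; intuition (subst; auto).
all: try by apply: hyp; left.
all: solve [econstructor; (apply: hyp || apply: mp); simpl; tauto].
Qed.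

Definition LETK_plus : deductive_system :=
  DeductiveSystem r_hyp LETKp_mono LETKp_cut LETKp_finitary LETKp_subst.

(* Main.v *)
Require Import Defs.
From HB Require Import structures.
From mathcomp Require Import all_boot boolp classical_sets cardinality.

Set Implicit Arguments.
Unset Strict Implicit.
Unset Printing Implicit Defensive.

Local Open Scope classical_set_scope.
Local Open Scope form_scope.

(** Two formulas are identified when they, their negations and their
    circlings are interderivable.  The introduction and elimination rules
    of LET_K^+ for A^T and A^F determine when a compound formula is circled
    from these data on its components, so this relation is a congruence of the
    formula algebra for every set of premises.  Moreover A is derivable exactly
    when it is identified with A ⊃ A.  Hence the Lindenbaum-Tarski algebras
    of all sets of premises form an equivalent algebraic semantics, with
    defining equation p ≈ p ⊃ p. *)

(** * Hypothetical interderivability and the formula expressing it *)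

Definition biimp (A B : form) : form := (A ⊃ B) ⋏ (B ⊃ A).

Definition delta : form :=
  biimp (Var 0) (Var 1) ⋏ biimp (∼ Var 0) (∼ Var 1)
    ⋏ biimp (∘ Var 0) (∘ Var 1).

(** Quantifying over all extensions of [Γ] makes each equivalence hypothetical: by the deduction
    theorem it amounts to a derivable biimplication, so [delta] can express the relation. *)
Definition indisc (Γ : set form) (A B : form) : Prop :=
  forall Δ, Γ `<=` Δ ->
    [/\ LETKp Δ A <-> LETKp Δ B, LETKp Δ (∼ A) <-> LETKp Δ (∼ B)
      & LETKp Δ (∘ A) <-> LETKp Δ (∘ B)].

Lemma derive_last Γ A : LETKp (Γ `|` [set A]) A.
Proof. by apply: r_hyp; right. Qed.

Lemma derive_weak Γ A B : LETKp Γ B -> LETKp (Γ `|` [set A]) B.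
Proof. by apply: LETKp_mono => C; left. Qed.

Hint Resolve derive_last derive_weak : core.

Lemma derive_impP Γ A B :
  LETKp Γ (A ⊃ B) <-> forall Δ, Γ `<=` Δ -> LETKp Δ A -> LETKp Δ B.
Proof.
split=> [dAB Δ sub | h]; first by apply: r_impE; apply: LETKp_mono dAB.
by apply: r_impI; apply: h => // C; left.
Qed.

Lemma derive_andP Γ A B : LETKp Γ (A ⋏ B) <-> LETKp Γ A /\ LETKp Γ B.
Proof.
split=> [d | [dA dB]]; last exact: r_andI.
by split; [apply: r_andEl d | apply: r_andEr d].
Qed.

Lemma derive_biimpP Γ A B : LETKp Γ (biimp A B) <->
  forall Δ, Γ `<=` Δ -> (LETKp Δ A <-> LETKp Δ B).
Proof.
rewrite derive_andP !derive_impP; split=> [[AB BA] Δ sub | h].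
  by split; [apply: AB | apply: BA].
by split=> Δ /h[].
Qed.

Lemma derive_deltaP Γ A B : LETKp Γ (inst2 delta A B) <-> indisc Γ A B.
Proof.
rewrite /inst2 /= -!/(biimp _ _) 2!derive_andP !derive_biimpP.
split=> [[[h1 h2] h3] Δ sub | h]; first by split; auto.
by split; first split; move=> Δ /h[].
Qed.

Lemma indisc_sym Γ A B : indisc Γ A B -> indisc Γ B A.
Proof. by move=> h Δ /h[? ? ?]; split; apply: iff_sym. Qed.

Lemma indisc_trans Γ A B C : indisc Γ A B -> indisc Γ B C -> indisc Γ A C.
Proof.
by move=> h1 h2 Δ sub; have [? ? ?] := h1 _ sub; have [? ? ?] := h2 _ sub;
  split; tauto.
Qed.

Lemma indisc_mono Γ Δ A B : Γ `<=` Δ -> indisc Γ A B -> indisc Δ A B.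
Proof. by move=> sub h Δ' sub'; apply: h => X /sub /sub'. Qed.

Lemma indisc_weak Γ A B C : indisc Γ A B -> indisc (Γ `|` [set C]) A B.
Proof. by apply: indisc_mono => X; left. Qed.

Lemma indisc_derive Γ A B : indisc Γ A B -> LETKp Γ A -> LETKp Γ B.
Proof. by case/(_ Γ (@subset_refl _ Γ)) => -[]. Qed.

Lemma indisc_derive_neg Γ A B :
  indisc Γ A B -> LETKp Γ (∼ A) -> LETKp Γ (∼ B).
Proof. by case/(_ Γ (@subset_refl _ Γ)) => _ []. Qed.

Lemma indisc_derive_circ Γ A B :
  indisc Γ A B -> LETKp Γ (∘ A) -> LETKp Γ (∘ B).
Proof. by case/(_ Γ (@subset_refl _ Γ)) => _ _ []. Qed.

Lemma indisc_derive_tru Γ A B :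
  indisc Γ A B -> LETKp Γ (tru A) -> LETKp Γ (tru B).
Proof. by case/(_ Γ (@subset_refl _ Γ)) => ? _ ?; rewrite !derive_andP; tauto. Qed.

Lemma indisc_derive_fls Γ A B :
  indisc Γ A B -> LETKp Γ (fls A) -> LETKp Γ (fls B).
Proof. by case/(_ Γ (@subset_refl _ Γ)) => _ ? ?; rewrite !derive_andP; tauto. Qed.

Hint Resolve indisc_weak indisc_derive indisc_derive_neg : core.
Hint Resolve indisc_derive_circ indisc_derive_tru indisc_derive_fls : core.

(** * Compatibility with the connectives *)

(** Excluded middle for circled formulas splits on [A] or [∼ A]; as [∘ A] stays derivable, the cases
    strengthen to [tru A] and [fls A]. *)
Lemma circ_cases Γ A C : LETKp Γ (∘ A) ->
  (forall Δ, Γ `<=` Δ -> LETKp Δ (tru A) -> LETKp Δ C) ->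
  (forall Δ, Γ `<=` Δ -> LETKp Δ (fls A) -> LETKp Δ C) ->
  LETKp Γ C.
Proof.
move=> dA dT dF; apply: r_orE (r_pem dA) _ _.
  by apply: dT => [X|]; [left | apply: r_andI; auto].
by apply: dF => [X|]; [left | apply: r_andI; auto].
Qed.

Definition derive_le (Γ : set form) (A B : form) : Prop :=
  [/\ LETKp Γ A -> LETKp Γ B, LETKp Γ (∼ A) -> LETKp Γ (∼ B)
    & LETKp Γ (∘ A) -> LETKp Γ (∘ B)].

(* The hypotheses on A, A' and B, B' are symmetric and stable under enlarging
   the premises, so one direction at one set of premises suffices. *)
Lemma indisc_congr (op : form -> form -> form) :
  (forall Γ A A' B B', indisc Γ A A' -> indisc Γ B B' ->
     derive_le Γ (op A B) (op A' B')) ->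
  forall Γ A A' B B', indisc Γ A A' -> indisc Γ B B' ->
     indisc Γ (op A B) (op A' B').
Proof.
move=> le Γ A A' B B' hA hB Δ sub.
have {}hA := indisc_mono sub hA; have {}hB := indisc_mono sub hB.
have [? ? ?] := le _ _ _ _ _ hA hB.
by have [? ? ?] := le _ _ _ _ _ (indisc_sym hA) (indisc_sym hB).
Qed.

Lemma indisc_and Γ A A' B B' : indisc Γ A A' -> indisc Γ B B' ->
  indisc Γ (A ⋏ B) (A' ⋏ B').
Proof.
apply: indisc_congr => {}Γ {}A {}A' {}B {}B' hA hB; split=> d.
- by move/derive_andP: d => [? ?]; apply: r_andI; eauto.
- by apply: r_nandE d _ _; [apply: r_nandIl | apply: r_nandIr]; eauto.
(* In either case the goal is reached as the first conjunct of [tru] or [fls] of the new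
   conjunction. *)
- apply: circ_cases d _ _ => Δ sub d; apply: r_andEl;
    have {}hA := indisc_mono sub hA; have {}hB := indisc_mono sub hB.
    by apply: r_andTI;
      [apply: indisc_derive_tru hA (r_andTEl d)
      | apply: indisc_derive_tru hB (r_andTEr d)].
  by apply: r_andFE d _ _; [apply: r_andFIl | apply: r_andFIr]; eauto.
Qed.

Lemma indisc_or Γ A A' B B' : indisc Γ A A' -> indisc Γ B B' ->
  indisc Γ (A ⋎ B) (A' ⋎ B').
Proof.
apply: indisc_congr => {}Γ {}A {}A' {}B {}B' hA hB; split=> d.
- by apply: r_orE d _ _; [apply: r_orIl | apply: r_orIr]; eauto.
- by move: (r_norEl d) (r_norEr d) => ? ?; apply: r_norI; eauto.
- apply: circ_cases d _ _ => Δ sub d; apply: r_andEl;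
    have {}hA := indisc_mono sub hA; have {}hB := indisc_mono sub hB.
    by apply: r_orTE d _ _; [apply: r_orTIl | apply: r_orTIr]; eauto.
  by apply: r_orFI;
    [apply: indisc_derive_fls hA (r_orFEl d)
    | apply: indisc_derive_fls hB (r_orFEr d)].
Qed.

Lemma indisc_imp Γ A A' B B' : indisc Γ A A' -> indisc Γ B B' ->
  indisc Γ (A ⊃ B) (A' ⊃ B').
Proof.
apply: indisc_congr => {}Γ {}A {}A' {}B {}B' hA hB; split=> d.
- apply: r_impI; apply: indisc_derive (indisc_weak hB) _.
  apply: r_impE (derive_weak _ d) _.
  exact: indisc_derive (indisc_sym (indisc_weak hA)) (derive_last _ _).
- by move: (r_nimpEl d) (r_nimpEr d) => ? ?; apply: r_nimpI; eauto.
- apply: circ_cases d _ _ => Δ sub d; apply: r_andEl;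
    have {}hA := indisc_mono sub hA; have {}hB := indisc_mono sub hB.
    by apply: r_impTE d _ _; [apply: r_impTIl | apply: r_impTIr]; eauto.
  by apply: r_impFI;
    [apply: indisc_derive hA (r_impFEl d)
    | apply: indisc_derive_fls hB (r_impFEr d)].
Qed.

Lemma indisc_neg Γ A A' : indisc Γ A A' -> indisc Γ (∼ A) (∼ A').
Proof.
(* Negation is treated as a binary operation ignoring its second argument, so [hA] fills both
   slots. *)
move=> hA; move: hA (hA); apply: (@indisc_congr (fun A _ => ∼ A)).
move=> {}Γ {}A {}A' _ _ hA _; split=> d; first by eauto.
  by apply: r_dnI; apply: indisc_derive hA (r_dnE d).
by apply: r_circnegI; apply: indisc_derive_circ hA (r_circnegE d).
Qed.

(* Since ∘∘A is an axiom, the formula ∘A behaves classically. *)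
Lemma indisc_circ Γ A A' : indisc Γ A A' -> indisc Γ (∘ A) (∘ A').
Proof.
move=> hA; move: hA (hA); apply: (@indisc_congr (fun A _ => ∘ A)).
move=> {}Γ {}A {}A' _ _ hA _; split=> d; first by eauto.
  apply: r_orE (r_pem (r_circcirc _ A')) _ _; last by [].
  (* Under [∘ A'] also [∘ A] holds, against [∼ ∘ A]; this pair explodes because [∘ ∘ A] is an
     axiom. *)
  apply: (@r_exp _ (∘ A)); [exact: r_circcirc | | by auto].
  exact: indisc_derive_circ (indisc_sym (indisc_weak hA)) (derive_last _ _).
exact: r_circcirc.
Qed.

Lemma indisc_impxx Γ A : indisc Γ A (A ⊃ A) <-> LETKp Γ A.
Proof.
have id Δ : LETKp Δ (A ⊃ A) by apply: r_impI.
split=> [/indisc_sym/indisc_derive|dA Δ sub]; first exact.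
have {}dA := LETKp_mono sub dA; split; split=> // d.
- exact: r_nimpI.
- exact: r_nimpEr d.
- by apply: r_andEl; apply: r_impTIr; apply: r_andI.
(* [tru (A ⊃ A)] splits into [fls A] and [tru A], and both contain [∘ A]. *)
- apply: (@r_impTE _ A A); first exact: r_andI.
    exact: r_andEl (derive_last _ _).
  exact: r_andEl (derive_last _ _).
Qed.

(** * The Lindenbaum-Tarski algebra of a set of premises *)

HB.instance Definition _ := gen_eqMixin form.
HB.instance Definition _ := gen_choiceMixin form.

Section Lindenbaum.
Variable Γ : set form.

Definition canon (A : form) : form := xget (Var 0) (indisc Γ A).

Lemma indisc_canon A : indisc Γ A (canon A).
Proof. by apply: (@xgetPex _ _ (indisc Γ A)); exists A. Qed.

Lemma canon_eq A B : canon A = canon B <-> indisc Γ A B.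
Proof.
split=> [AB | AB].
  apply: indisc_trans (indisc_canon A) _; rewrite AB.
  exact/indisc_sym/indisc_canon.
(* The two classes coincide as predicates, so the same formula is chosen from both. *)
rewrite /canon; congr xget; apply: funext => C; apply/propext; split.
  exact/indisc_trans/indisc_sym.
exact: indisc_trans.
Qed.

(* Canonical representatives are used because MathComp's [{eq_quot _}] lives in
   a universe too large for [carrier]. *)
Definition lindenbaum_carrier : Type := {A : form | canon A = A}.

Definition cls (A : form) : lindenbaum_carrier :=
  exist _ (canon A) (proj2 (canon_eq _ _) (indisc_sym (indisc_canon A))).

Definition repr (x : lindenbaum_carrier) : form := sval x.

Lemma reprK x : cls (repr x) = x.
Proof. by case: x => A e; apply: eq_exist. Qed.

Lemma cls_eq A B : cls A = cls B <-> indisc Γ A B.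
Proof.
rewrite -canon_eq; split=> [/(congr1 repr) //|AB]; exact: eq_exist.
Qed.

Lemma indisc_repr A : indisc Γ (repr (cls A)) A.
Proof. exact/indisc_sym/indisc_canon. Qed.

Definition lindenbaum : algebra :=
  @Algebra lindenbaum_carrier (inhabits (cls (Var 0)))
    (fun x y => cls (repr x ⋏ repr y))
    (fun x y => cls (repr x ⋎ repr y))
    (fun x y => cls (repr x ⊃ repr y))
    (fun x => cls (∼ repr x))
    (fun x => cls (∘ repr x)).

(** Picking representatives turns a valuation in the quotient into a substitution; the congruence
    lemmas carry the induction. *)
Lemma eval_lindenbaum (v : nat -> lindenbaum) A :
  eval v A = cls (subst (repr \o v) A).
Proof.
elim: A => /= [n | A -> B -> | A -> B -> | A -> B -> | A -> | A ->].
- by rewrite reprK.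
- by apply/cls_eq; apply: indisc_and; apply: indisc_repr.
- by apply/cls_eq; apply: indisc_or; apply: indisc_repr.
- by apply/cls_eq; apply: indisc_imp; apply: indisc_repr.
- by apply/cls_eq; apply: indisc_neg; apply: indisc_repr.
- by apply/cls_eq; apply: indisc_circ; apply: indisc_repr.
Qed.

Lemma satisfies_lindenbaum (v : nat -> lindenbaum) e :
  satisfies v e <->
  indisc Γ (subst (repr \o v) e.1) (subst (repr \o v) e.2).
Proof. by rewrite /satisfies !eval_lindenbaum cls_eq. Qed.

(** Makes [cls \o Var] the canonical valuation: the formulas designated under it are exactly those
    derivable from [Γ]. *)
Lemma subst_repr_cls A : indisc Γ (subst (repr \o (cls \o Var)) A) A.
Proof.
elim: A => /= [n | A hA B hB | A hA B hB | A hA B hB | A hA | A hA].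
- exact: indisc_repr.
- exact: indisc_and.
- exact: indisc_or.
- exact: indisc_imp.
- exact: indisc_neg.
- exact: indisc_circ.
Qed.

End Lindenbaum.

Arguments repr {Γ} x.

(** * Translation into equations and algebraizability *)

Definition defeq : equation := (Var 0, Var 0 ⊃ Var 0).

Lemma sat_to_equations Γ Δ (v : nat -> lindenbaum Γ) :
  (forall e, to_equations [set defeq] Δ e -> satisfies v e) <->
  (forall A, Δ A -> LETKp Γ (subst (repr \o v) A)).
Proof.
split=> [h A DA | h _ [_ -> [A DA <-]]].
  suff /h/satisfies_lindenbaum/indisc_impxx :
      to_equations [set defeq] Δ (A, A ⊃ A) by [].
  by exists defeq => //; exists A.
by apply/satisfies_lindenbaum/indisc_impxx/h.
Qed.

Theorem theorem3p18 : algebraizable LETK_plus.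
Proof.
exists (range lindenbaum), [set defeq], [set delta]; split.
- split=> [|_ ->]; first exact: finite_set1.
  by split=> //= n [].
- split=> [|_ -> n /=]; [exact: finite_set1 | tauto].
split=> [Γ A | A B].
  split=> [dA e Ee _ [Δ _ <-] v hΓ | h].
    suff h : forall B, [set A] B -> LETKp Δ (subst (repr \o v) B).
      exact: (proj2 (sat_to_equations _ _) h).
    (* Soundness: structurality carries the derivation along the substitution, and cut removes the
       substituted premises. *)
    move=> _ ->; apply: LETKp_cut (LETKp_subst _ dA) => _ [B GB <-].
    exact: (proj1 (sat_to_equations _ _) hΓ).
  (* Completeness: the canonical valuation in the algebra of [Γ] itself satisfies the translated
     premises. *)
  pose v : nat -> lindenbaum Γ := @cls Γ \o Var.
  apply: (indisc_derive (subst_repr_cls A)).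
  apply: (proj1 (sat_to_equations [set A] v)) => // e Ee.
  apply: (h e Ee); first by exists Γ.
  apply/sat_to_equations => B GB.
  by apply: indisc_derive (indisc_sym (subst_repr_cls B)) _; apply: r_hyp.
have sat_delta Γ (v : nat -> lindenbaum Γ) :
    (forall e, to_equations [set defeq] (to_formulas [set delta] A B) e ->
       satisfies v e) <-> satisfies v (A, B).
  (* Substitution commutes with [inst2 delta] by computation, so [derive_deltaP] applies to the
     substituted formulas. *)
  rewrite sat_to_equations satisfies_lindenbaum -derive_deltaP; split.
    by move/(_ (inst2 delta A B)); apply; exists delta.
  by move=> h _ [_ -> <-].
split=> e.
  move=> Ee _ [Γ _ <-] v h.
  by apply: (proj2 (sat_delta _ v)) => //; apply: h.
by move=> -> _ [Γ _ <-] v /sat_delta.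
Qed.
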